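(* Let $\mathcal{H}$ be a complex Hilbert space, let $\mathfrak{M}\subseteq B(\mathcal{H})$ be a von Neumann algebra with commutant $\mathfrak{M}'$, and let $\xi\in\mathcal{H}$, $\|\xi\|=1$, be a cyclic and separating vector for $\mathfrak{M}$. Define conjugate-linear operators in $\mathcal{H}$ by $\operatorname{dom}S_\xi=\mathfrak{M}\xi$, $S_\xi(m\xi)=m^\star\xi$ for $m\in\mathfrak{M}$, and $\operatorname{dom}F_\xi=\mathfrak{M}'\xi$, $F_\xi(m'\xi)=(m')^\star\xi$ for $m'\in\mathfrak{M}'$. Then $(S_\xi,F_\xi)$ is a maximal symmetric pair, so that $\overline{S_\xi}=F_\xi^\star$ and $\overline{F_\xi}=S_\xi^\star$.
   Context: $\mathfrak{M}'=\{x\in B(\mathcal{H}): xm=mx\ \forall m\in\mathfrak{M}\}$. The unit vector $\xi$ is $\mathfrak{M}$-cyclic if $\mathfrak{M}\xi=\{m\xi:m\in\mathfrak{M}\}$ is dense in $\mathcal{H}$, and $\mathfrak{M}$-separating if $\mathfrak{M}'\xi=\{m'\xi:m'\in\mathfrak{M}'\}$ is dense in $\mathcal{H}$ (equivalently, $m\xi=0$ with $m\in\mathfrak{M}$ implies $m=0$). A pair $(A,B)$ of densely defined conjugate-linear operators $A:\operatorname{dom}A\subseteq\mathcal{H}_1\to\mathcal{H}_2$, $B:\operatorname{dom}B\subseteq\mathcal{H}_2\to\mathcal{H}_1$ is a symmetric pair if $\langle A\varphi,\psi\rangle_{\mathcal{H}_2}=\overline{\langle\varphi,B\psi\rangle_{\mathcal{H}_1}}$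 for all $\varphi\in\operatorname{dom}A$, $\psi\in\operatorname{dom}B$. The adjoint of a densely defined conjugate-linear operator $A$ is the conjugate-linear operator $A^\star$ determined by $\langle A\varphi,\psi\rangle=\overline{\langle\varphi,A^\star\psi\rangle}$ for all $\varphi\in\operatorname{dom}A$, its domain consisting of all $\psi$ for which such a vector $A^\star\psi$ exists. Members of a symmetric pair are closable, and $\overline{A}$ denotes the closure of $A$ (the operator whose graph is the closure of the graph of $A$). A symmetric pair $(A,B)$ is maximal if $\overline{A}=B^\star$ and $\overline{B}=A^\star$. *)

(* Defs.v *)
From HB Require Import structures.
From mathcomp Require Import all_boot all_order all_algebra sesquilinear.
From mathcomp Require Import complex.
From mathcomp Require Import boolp classical_sets functions reals.
From mathcomp Require Import topology normedtype.

Set Implicit Arguments.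
Unset Strict Implicit.
Unset Printing Implicit Defensive.

Import Order.TTheory GRing.Theory Num.Theory.
Import numFieldNormedType.Exports.

Local Open Scope classical_set_scope.
Local Open Scope ring_scope.
Local Open Scope complex_scope.

(* Complex Hilbert spaces. The scalar field is [R[i]] for a real line
   [R : realType]. The form is linear in its first and conjugate-linear in its
   second argument; none of the notions below depends on that choice, because
   exchanging the two arguments conjugates both sides of every equation. *)
HB.mixin Record CompleteNormedModule_isHilbert (R : realType) H
    & CompleteNormedModule R[i] H := {
  inner : {dot H for Num.conj};
  inner_norm : forall x : H, `|x| ^+ 2 = inner x x
}.

#[short(type="hilbertType")]
HB.structure Definition Hilbert (R : realType) :=
  {H of CompleteNormedModule R[i] H & CompleteNormedModule_isHilbert R H}.

Notation "''[' u , v ]" := (inner u v) : ring_scope.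

Section BoundedOperators.
Context {R : realType} {H : hilbertType R}.
Implicit Types (T : H -> H) (M : set (H -> H)).

Definition bounded_operators : set (H -> H) :=
  [set T | linear T /\ exists C : R[i], forall x, `|T x| <= C * `|x|].

(* [adj T y] is the vector representing the functional [x |-> '[T x, y]]; it
   exists (Riesz) and is unique when [T] is bounded, so that the default value
   0 of [xget] is irrelevant there. *)
Definition adj T : H -> H :=
  fun y => xget 0 [set z | forall x, '[T x, y] = '[x, z]].

Definition commutant M : set (H -> H) :=
  [set T | bounded_operators T /\ forall m, M m -> T \o m = m \o T].

(* The sets [S | forall p in s, |<(T - S) p.1, p.2>| < e], for finite [s] and
   [e > 0], are a basis of neighbourhoods of [T] in the weak operator
   topology. *)
Definition wot_closure M : set (H -> H) :=
  [set T | bounded_operators T /\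
    forall (s : seq (H * H)) (e : R[i]), 0 < e ->
      exists2 S, M S &
        forall p, p \in s -> `|'[T p.1 - S p.1, p.2]| < e].

Record von_neumann_algebra M : Prop := {
  vna_bounded : M `<=` bounded_operators;
  vna_id : M idfun;
  vna_add : forall S T, M S -> M T -> M (S \+ T);
  vna_scale : forall (c : R[i]) T, M T -> M (c \*: T);
  vna_comp : forall S T, M S -> M T -> M (S \o T);
  vna_adj : forall T, M T -> M (adj T);
  vna_closed : wot_closure M `<=` M
}.

Definition cyclic_vector M (xi : H) := dense [set m xi | m in M].

Definition separating_vector M (xi : H) := dense [set m xi | m in commutant M].

End BoundedOperators.

(* A partially defined operator from [H1] to [H2] is represented by its graph,
   a subset of [H1 * H2]; its domain is then the first projection [A.`1] and
   its closure is the topological [closure] in the product. *)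
Section ConjugateLinearOperators.
Context {R : realType} {H1 H2 : hilbertType R}.
Implicit Type A : set (H1 * H2).

Record conj_linear_operator A : Prop := {
  clo_functional : forall x y z, A (x, y) -> A (x, z) -> y = z;
  clo_zero : A (0, 0);
  clo_conj_linear : forall (c : R[i]) x y x' y', A (x, y) -> A (x', y') ->
    A (c *: x + x', Num.conj c *: y + y')
}.

Definition densely_defined A := dense A.`1.

(* [(psi, eta)] is in the graph of the adjoint iff [eta] is an admissible value
   of the adjoint at [psi]; [eta] is unique when [A] is densely defined. *)
Definition conj_adjoint A : set (H2 * H1) :=
  [set q | forall phi Aphi, A (phi, Aphi) ->
     '[Aphi, q.1] = Num.conj '[phi, q.2]].

End ConjugateLinearOperators.

Section SymmetricPairs.
Context {R : realType} {H1 H2 : hilbertType R}.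
Implicit Types (A : set (H1 * H2)) (B : set (H2 * H1)).

Record symmetric_pair A B : Prop := {
  sp_left : conj_linear_operator A;
  sp_right : conj_linear_operator B;
  sp_left_dense : densely_defined A;
  sp_right_dense : densely_defined B;
  sp_symmetric : forall phi Aphi psi Bpsi, A (phi, Aphi) -> B (psi, Bpsi) ->
    '[Aphi, psi] = Num.conj '[phi, Bpsi]
}.

Record maximal_symmetric_pair A B : Prop := {
  msp_symmetric_pair : symmetric_pair A B;
  msp_left : closure A = conj_adjoint B;
  msp_right : closure B = conj_adjoint A
}.

End SymmetricPairs.

Section TomitaOperators.
Context {R : realType} {H : hilbertType R}.
Implicit Types (M : set (H -> H)) (xi : H).

Definition S_op M xi : set (H * H) := [set (m xi, adj m xi) | m in M].

Definition F_op M xi : set (H * H) :=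
  [set (m' xi, adj m' xi) | m' in commutant M].

End TomitaOperators.

(* Main.v *)
Require Import Defs.
From mathcomp Require Import all_boot all_order all_algebra.
From mathcomp Require Import classical_sets reals topology normedtype.
From mathcomp Require Import sesquilinear complex boolp.
From mathcomp Require Import ring lra.

(** Let [K] be the real space [{a xi | a = a^*
    in M}]. If [(psi, eta)] is in the graph of the adjoint of [F_xi], then
    [psi = x + 'i y] and [eta = x - 'i y], where [<b xi, x>] and [<b xi, y>] are
    real for all self-adjoint [b] in the commutant. The components of [x] and
    [y] orthogonal to [K] for [Re <,>] vanish because [K + 'i K'] is dense,
    where [K'] is built from the commutant; so [x] and [y] are limits of
    elements of [K]. Exchanging [M] and its commutant replaces [K + 'i K'] by
    [K' + 'i K = 'i (K + 'i K')], which gives the other equality.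

    For the density, let [z] be orthogonal to [K + 'i K'] for [Re <,>]. Then
    [|m (xi + z)| = |m (xi - z)|] for all [m] in [M], so that a contraction
    [w] in the commutant maps [xi + z] to [xi - z]. Since
    [Re <w xi, z> = Re <w z, xi>], the squared norm of
    [w xi - xi = - (z + w z)] is at most [c] and at most [- c] with
    [c = 2 Re <w xi, z>]. Hence [w xi = xi] and [w z = - z]; as [xi] is cyclic,
    [w] is the identity and [z = 0]. *)

Set Implicit Arguments.
Unset Strict Implicit.
Unset Printing Implicit Defensive.

Import Order.TTheory GRing.Theory Num.Theory.
Import numFieldNormedType.Exports.

Local Open Scope classical_set_scope.
Local Open Scope ring_scope.
Local Open Scope complex_scope.

(** * Real and imaginary parts of complex scalars *)

Section RealPart.
Context {R : realType}.
Implicit Types z w : R[i].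

Lemma cReD z w : complex.Re (z + w) = complex.Re z + complex.Re w.
Proof. by case: z; case: w. Qed.
Lemma cImD z w : complex.Im (z + w) = complex.Im z + complex.Im w.
Proof. by case: z; case: w. Qed.
Lemma cReN z : complex.Re (- z) = - complex.Re z.
Proof. by case: z. Qed.
Lemma cImN z : complex.Im (- z) = - complex.Im z.
Proof. by case: z. Qed.
Lemma cReM z w :
  complex.Re (z * w) = complex.Re z * complex.Re w - complex.Im z * complex.Im w.
Proof. by case: z; case: w. Qed.
Lemma cImM z w :
  complex.Im (z * w) = complex.Re z * complex.Im w + complex.Im z * complex.Re w.
Proof. by case: z => a b; case: w. Qed.
Lemma cReJ z : complex.Re (Num.conj z) = complex.Re z.
Proof. by case: z. Qed.
Lemma cImJ z : complex.Im (Num.conj z) = - complex.Im z.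
Proof. by case: z. Qed.
Lemma conj_realC (t : R) : Num.conj t%:C = t%:C.
Proof. by apply/eqP; rewrite eq_complex /= oppr0 !eqxx. Qed.
Lemma conj_iC : Num.conj ('i : R[i]) = - 'i.
Proof. by apply/eqP; rewrite eq_complex /= oppr0 !eqxx. Qed.
Lemma complex_ext z w :
  complex.Re z = complex.Re w -> complex.Im z = complex.Im w -> z = w.
Proof. by case: z w => a b [c d] /= -> ->. Qed.

End RealPart.

(** * [H] as a real inner product space *)

Section RealGeometry.
Context {R : realType} {H : hilbertType R}.
Implicit Types (x y z : H) (t : R) (c : R[i]).

Lemma inner_conj x y : '[x, y] = Num.conj '[y, x].
Proof. by have := hermC (inner : {dot H for Num.conj}) x y; rewrite expr0 mul1r. Qed.

Lemma innerDl x y z : '[x + y, z] = '[x, z] + '[y, z].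
Proof. exact: linearDl. Qed.
Lemma innerDr x y z : '[x, y + z] = '[x, y] + '[x, z].
Proof. exact: linearDr. Qed.
Lemma innerBl x y z : '[x - y, z] = '[x, z] - '[y, z].
Proof. exact: linearBl. Qed.
Lemma innerBr x y z : '[x, y - z] = '[x, y] - '[x, z].
Proof. exact: linearBr. Qed.
Lemma innerNl x y : '[- x, y] = - '[x, y].
Proof. exact: linearNl. Qed.
Lemma innerZl c x y : '[c *: x, y] = c * '[x, y].
Proof. exact: linearZl_LR. Qed.
Lemma innerZr c x y : '[x, c *: y] = Num.conj c * '[x, y].
Proof. exact: linearZr_LR. Qed.
Lemma inner0l x : '[0, x] = 0.
Proof. exact: linear0l. Qed.
Lemma inner0r x : '[x, 0] = 0.
Proof. exact: linear0r. Qed.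

(** The norm of [H] takes its values in [R[i]]. With these real-valued forms, orthogonality over the
    reals can be stated and inequalities live in the ordered field [R]. *)
Definition rinner x y : R := complex.Re '[x, y].
Definition rnorm x : R := complex.Re `|x|.

Lemma normE x : `|x| = (rnorm x)%:C.
Proof. by rewrite /rnorm RRe_real // normr_real. Qed.

Lemma rnorm_ge0 x : 0 <= rnorm x.
Proof. by have := normr_ge0 x; rewrite normE ler0c. Qed.

Lemma rnormD x y : rnorm (x + y) <= rnorm x + rnorm y.
Proof. by have := ler_normD x y; rewrite !normE -rmorphD lecR. Qed.

Lemma rnormN x : rnorm (- x) = rnorm x.
Proof. by rewrite /rnorm normrN. Qed.

Lemma rnormC x y : rnorm (x - y) = rnorm (y - x).
Proof. by rewrite -rnormN opprB. Qed.

Lemma rnorm_eq0 x : rnorm x = 0 -> x = 0.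
Proof. by move=> x0; apply/eqP; rewrite -normr_eq0 normE x0. Qed.

Lemma rnormZ c x : rnorm (c *: x) = complex.Re `|c| * rnorm x.
Proof.
rewrite /rnorm normrZ cReM.
by rewrite (ger0_Im (normr_ge0 c)) mul0r subr0.
Qed.

Lemma inner_self x : '[x, x] = (rnorm x ^+ 2)%:C.
Proof. by rewrite -inner_norm normE rmorphXn. Qed.

Lemma rnorm2 x : rnorm x ^+ 2 = rinner x x.
Proof. by rewrite /rinner inner_self. Qed.

Lemma rinnerC x y : rinner x y = rinner y x.
Proof. by rewrite /rinner inner_conj cReJ. Qed.
Lemma rinnerDl x y z : rinner (x + y) z = rinner x z + rinner y z.
Proof. by rewrite /rinner innerDl cReD. Qed.
Lemma rinnerBl x y z : rinner (x - y) z = rinner x z - rinner y z.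
Proof. by rewrite /rinner innerBl cReD cReN. Qed.
Lemma rinnerDr x y z : rinner x (y + z) = rinner x y + rinner x z.
Proof. by rewrite /rinner innerDr cReD. Qed.
Lemma rinnerBr x y z : rinner x (y - z) = rinner x y - rinner x z.
Proof. by rewrite /rinner innerBr cReD cReN. Qed.
Lemma rinnerZl t x y : rinner (t%:C *: x) y = t * rinner x y.
Proof. by rewrite /rinner innerZl cReM mul0r subr0. Qed.
Lemma rinnerZr t x y : rinner x (t%:C *: y) = t * rinner x y.
Proof. by rewrite rinnerC rinnerZl rinnerC. Qed.

Definition rinnerE :=
  (rinnerBl, rinnerBr, rinnerDl, rinnerDr, rinnerZl, rinnerZr).

Lemma Im_inner x y : complex.Im '[x, y] = rinner x ('i *: y).
Proof. by rewrite /rinner innerZr conj_iC cReM /=; ring. Qed.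

Lemma rinner_ge0 x : 0 <= rinner x x.
Proof. by rewrite -rnorm2 sqr_ge0. Qed.

(** Cauchy-Schwarz: for non-zero [x] and [y], the squared norm of [|y| x - |x| y] is
    [2 |x| |y| (|x| |y| - Re <x, y>)]. *)
Lemma rinner_le x y : rinner x y <= rnorm x * rnorm y.
Proof.
have [y0|y0] := eqVneq (rnorm y) 0.
  by rewrite (rnorm_eq0 y0) /rinner inner0r mulr_ge0 ?rnorm_ge0.
have [x0|x0] := eqVneq (rnorm x) 0.
  by rewrite (rnorm_eq0 x0) /rinner inner0l mulr_ge0 ?rnorm_ge0.
have := rinner_ge0 ((rnorm y)%:C *: x - (rnorm x)%:C *: y).
rewrite !rinnerE -!rnorm2. rewrite (rinnerC y x).
set a := rnorm x in x0 *; set b := rnorm y in y0 *.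
have a0 : 0 < a by rewrite lt0r x0 rnorm_ge0.
have b0 : 0 < b by rewrite lt0r y0 rnorm_ge0.
have -> : b * (b * a ^+ 2 - a * rinner x y) - a * (b * rinner x y - a * b ^+ 2)
  = (2 * (a * b)) * (a * b - rinner x y) by ring.
by rewrite pmulr_rge0 ?subr_ge0// !mulr_gt0.
Qed.

Lemma rinner_ge x y : - (rnorm x * rnorm y) <= rinner x y.
Proof.
have := rinner_le (- x) y; rewrite rnormN.
by rewrite {1}/rinner innerNl cReN -/(rinner x y); lra.
Qed.

Lemma eq0_rinner x : (forall y, rinner y x = 0) -> x = 0.
Proof.
by move=> /(_ x) x0; apply: rnorm_eq0; apply/eqP; rewrite -sqrf_eq0 rnorm2 x0.
Qed.

Lemma eq_innerr y z : (forall x, '[x, y] = '[x, z]) -> y = z.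
Proof.
move=> e; apply/eqP; rewrite -subr_eq0; apply/eqP/eq0_rinner => x.
by rewrite rinnerBr /rinner e subrr.
Qed.

End RealGeometry.

(** * Closure, density and completeness in terms of the real norm *)

Section Closure.
Context {R : realType} {H : hilbertType R}.
Implicit Types (x y : H) (A : set H) (G : set (H * H)).

Lemma rball x (e : R) y : ball x e%:C y <-> rnorm (x - y) < e.
Proof. by rewrite -ball_normE /= normE ltcR. Qed.

Lemma nbhs_rballP x A :
  nbhs x A <-> exists2 e : R, 0 < e & forall y, rnorm (x - y) < e -> A y.
Proof.
split=> [/nbhs_ballP[/= e e0 eA]|[e e0 eA]].
  have er : e = (complex.Re e)%:C by rewrite RRe_real// gtr0_real.
  exists (complex.Re e); first by rewrite -ltcR -er.
  by move=> y /rball yx; apply: eA; rewrite er.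
by apply/nbhs_ballP; exists e%:C => /=; [rewrite ltcR | move=> y /rball; exact: eA].
Qed.

Lemma closure_rnormP A x :
  closure A x <-> forall e : R, 0 < e -> exists2 y, A y & rnorm (x - y) < e.
Proof.
split=> [Ax e e0|Ax B /nbhs_rballP[e e0 eB]].
  have [|y [Ay yx]] := Ax [set y | rnorm (x - y) < e].
    by apply/nbhs_rballP; exists e.
  by exists y.
by have [y Ay xy] := Ax e e0; exists y; split=> //; apply: eB.
Qed.

Lemma closure_prodP G x y :
  closure G (x, y) <-> forall e : R, 0 < e ->
    exists a b, [/\ G (a, b), rnorm (x - a) < e & rnorm (y - b) < e].
Proof.
split=> [Gx e e0|Gx B].
  have [|[a b] [Gab [ax bx]]] := Gx ([set a | rnorm (x - a) < e] `*` [set b | rnorm (y - b) < e]).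
    exists ([set a | rnorm (x - a) < e], [set b | rnorm (y - b) < e]) => //=.
    by split; apply/nbhs_rballP; exists e.
  by exists a, b.
case=> -[B1 B2] /= [/nbhs_rballP[e e0 eB] /nbhs_rballP[f f0 fB]] sB.
have [|a [b [Gab ax bx]]] := Gx (Num.min e f); first by rewrite lt_min e0.
exists (a, b); split=> //; apply: sB; split=> /=.
  by apply: eB; apply: lt_le_trans ax _; rewrite ge_min lexx.
by apply: fB; apply: lt_le_trans bx _; rewrite ge_min lexx orbT.
Qed.

Lemma dense_closure A : dense A <-> forall x, closure A x.
Proof.
split=> [dA x B /nbhs_rballP[e e0 eB]|dA O [x Ox] oO].
  have := dA (interior B); rewrite setIC; case.
  - by exists x; apply/nbhs_rballP; exists e.
  - exact: open_interior.
  - by move=> y [Ay /interior_subset By]; exists y; split.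
have [y [Ay Oy]] := dA x O (open_nbhs_nbhs (conj oO Ox)).
by exists y.
Qed.

Lemma rnorm_complete (u : nat -> H) :
  (forall e : R, 0 < e -> exists n0, forall m n,
     (n0 <= m)%N -> (n0 <= n)%N -> rnorm (u m - u n) < e) ->
  exists l, forall e : R, 0 < e -> exists n0, forall n,
     (n0 <= n)%N -> rnorm (l - u n) < e.
Proof.
move=> cu.
have cF : cauchy (u @ \oo).
  apply: cauchy_exP => e e0.
  have er : e = (complex.Re e)%:C by rewrite RRe_real// gtr0_real.
  have [|n0 h] := cu (complex.Re e); first by rewrite -ltcR -er.
  exists (u n0); exists n0 => // n /= n0n.
  by rewrite er; apply/rball; apply: h.
have ul : u @ \oo --> lim (u @ \oo) := cauchy_cvg (u @ \oo) cF.
exists (lim (u @ \oo)) => e e0.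
have /ul[n0 _ h] : nbhs (lim (u @ \oo)) [set y | rnorm (lim (u @ \oo) - y) < e].
  by apply/nbhs_rballP; exists e.
by exists n0 => n n0n; apply: h.
Qed.

End Closure.

(** * Orthogonal projection onto the closure of a real subspace *)

Section Projection.
Context {R : realType} {H : hilbertType R}.
Implicit Types (x y : H) (K : set H).

(** This replaces passages to the limit below: a quantity is estimated by a fixed multiple of the
    error [e] of an approximation. If [a] were positive, [e = a / (2 (|C| + 1))] would give
    [a <= a / 2]. *)
Lemma le0_small (a C : R) : (forall e, 0 < e -> a <= e * C) -> a <= 0.
Proof.
move=> aC; rewrite leNgt; apply/negP => a0.
have C1 : 0 < `|C| + 1 by rewrite ltr_wpDl.
have := aC (a / (2 * (`|C| + 1))); rewrite divr_gt0 ?mulr_gt0// => /(_ isT).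
have : a / (2 * (`|C| + 1)) * C <= a / (2 * (`|C| + 1)) * (`|C| + 1).
  rewrite ler_pM2l ?divr_gt0 ?mulr_gt0//.
  by rewrite (le_trans (ler_norm C))// lerDl.
have -> : a / (2 * (`|C| + 1)) * (`|C| + 1) = a / 2.
  by field; rewrite gt_eqF.
by lra.
Qed.

Lemma invS_small (e : R) : 0 < e ->
  exists n0, forall n, (n0 <= n)%N -> n.+1%:R^-1 < e.
Proof.
move=> e0; pose n0 := Num.bound e^-1.
have n0e : e^-1 < n0%:R.
  by apply: archi_boundP; rewrite invr_ge0 ltW.
exists n0 => n n0n; rewrite invf_plt ?posrE// (lt_le_trans n0e)//.
by rewrite ler_nat leqW.
Qed.

Record real_subspace K : Prop := {
  rs_zero : K 0;
  rs_add : forall x y, K x -> K y -> K (x + y);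
  rs_scale : forall (t : R) x, K x -> K (t%:C *: x)
}.

(** A minimising sequence in [K] for the distance to [x] is Cauchy, and its limit is the nearest
    point of the closure. As [K] itself may fail to be closed, orthogonality is first estimated
    along the sequence. *)
Lemma real_projection K x : real_subspace K ->
  exists2 p, closure K p & forall k, K k -> rinner k (x - p) = 0.
Proof.
move=> [K0 KD KZ].
pose D := [set rnorm (x - k) ^+ 2 | k in K].
have D_inf : has_inf D.
  split; first by exists (rnorm (x - 0) ^+ 2), 0.
  by exists 0 => _ [k _ <-]; rewrite sqr_ge0.
have dK k : K k -> inf D <= rnorm (x - k) ^+ 2.
  by move=> Kk; apply: ge_inf; [exact: D_inf.2 | exists k].
pose d := inf D.
have /choice[u uP] n : exists k, K k /\ rnorm (x - k) ^+ 2 < d + n.+1%:R^-1.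
  have n0 : 0 < n.+1%:R^-1 :> R by rewrite invr_gt0.
  by have [_ [k Kk <-] kd] := inf_adherent n0 D_inf; exists k.
(* Parallelogram law: the midpoint of [u m] and [u n] lies in [K], so its squared distance to [x] is
   at least [d]. Hence [|u m - u n|^2] is less than [2 (1/(m+1) + 1/(n+1))], which explains
   [e ^+ 2 / 4]. *)
have cauchy_u (e : R) : 0 < e -> exists n0, forall m n,
    (n0 <= m)%N -> (n0 <= n)%N -> rnorm (u m - u n) < e.
  move=> e0; have [|n0 h] := @invS_small (e ^+ 2 / 4); first by rewrite divr_gt0 ?exprn_gt0.
  exists n0 => m n /h hm /h hn.
  have [Km um] := uP m; have [Kn un] := uP n.
  have := dK _ (KZ (2^-1) _ (KD _ _ Km Kn)); rewrite -/d.
  rewrite -ltr_sqr ?nnegrE ?rnorm_ge0 ?(ltW e0)//.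
  move: um un; rewrite !rnorm2 !rinnerE.
  rewrite (rinnerC (u n) (u m)) (rinnerC (u m) x) (rinnerC (u n) x).
  move: hm hn; rewrite /=.
  move: (m.+1%:R^-1 : R) (n.+1%:R^-1 : R) (e ^+ 2 : R) => a b c.
  by lra.
have [p up] := rnorm_complete cauchy_u.
exists p.
  apply/closure_rnormP => e /up[n0 h]; exists (u n0); last exact: h.
  by have [] := uP n0.
move=> k Kk.
(* The point [u n + t k] of [K] is no closer to [x] than the infimum allows. The resulting quadratic
   inequality [q] in [t] is used at [t = <k, x - u n> / <k, k>], where it is sharpest. *)
have u_orth n : rinner k (x - u n) ^+ 2 <= n.+1%:R^-1 * rinner k k.
  have [Kn un] := uP n.
  have q t : 2 * t * rinner k (x - u n) <= n.+1%:R^-1 + t ^+ 2 * rinner k k.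
    have := dK _ (KD _ _ Kn (KZ t _ Kk)); rewrite -/d.
    move: un; rewrite !rnorm2 opprD addrA.
    move: (x - u n) => w; rewrite !rinnerE (rinnerC w k).
    rewrite expr2; move: (n.+1%:R^-1 : R) => a.
    by lra.
  have [k0|k0] := eqVneq (rinner k k) 0.
    have -> : rinner k (x - u n) = 0.
      have -> : k = 0 by apply: rnorm_eq0; apply/eqP; rewrite -sqrf_eq0 rnorm2 k0.
      by rewrite /rinner inner0l.
    by rewrite k0 mulr0 expr0n.
  have kp : 0 < rinner k k by rewrite lt0r k0 rinner_ge0.
  have := q (rinner k (x - u n) / rinner k k).
  set r := rinner k (x - u n); set kk := rinner k k in k0 kp *.
  have -> : r ^+ 2 = r ^+ 2 / kk * kk by field.
  have -> : 2 * (r / kk) * r = 2 * (r ^+ 2 / kk) by field.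
  have -> : (r / kk) ^+ 2 * kk = r ^+ 2 / kk by field.
  rewrite ler_pM2r//; move: (n.+1%:R^-1 : R) (r ^+ 2 / kk) => a b.
  by lra.
set r := rinner k (x - p).
apply/eqP; rewrite -normr_eq0 eq_le normr_ge0 andbT.
apply: (@le0_small _ (2 * rnorm k)) => e e0.
have [n1 h1] := up e e0; have [|n2 h2] := @invS_small (e ^+ 2); first by rewrite exprn_gt0.
pose n := maxn n1 n2.
have pn : rnorm (p - u n) < e by apply: h1; rewrite leq_maxl.
have en : n.+1%:R^-1 < e ^+ 2 by apply: h2; rewrite leq_maxr.
have : `|rinner k (x - u n)| <= e * rnorm k.
  rewrite -ler_sqr ?nnegrE ?mulr_ge0 ?rnorm_ge0 ?(ltW e0)//.
  rewrite real_normK ?num_real// exprMn rnorm2.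
  apply: le_trans (u_orth n) _.
  by rewrite ler_wpM2r ?rinner_ge0// ltW.
have -> : r = rinner k (x - u n) - rinner k (p - u n).
  by rewrite /r !rinnerE; ring.
have : `|rinner k (p - u n)| <= rnorm k * e.
  have : rnorm k * rnorm (p - u n) <= rnorm k * e by rewrite ler_wpM2l ?rnorm_ge0 ?ltW.
  by rewrite ler_norml; have := rinner_le k (p - u n); have := rinner_ge k (p - u n); lra.
have := ler_normB (rinner k (x - u n)) (rinner k (p - u n)).
lra.
Qed.

End Projection.

(** * Riesz representation and adjoints of bounded operators *)

Section Adjoint.
Context {R : realType} {H : hilbertType R}.
Implicit Types (x y z : H) (S T : H -> H) (c : R[i]).

Lemma bounded_operatorP T :
  bounded_operators T <->
  linear T /\ exists2 C : R, 0 <= C & forall x, rnorm (T x) <= C * rnorm x.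
Proof.
split=> -[linT].
  case=> C TC; split=> //; exists `|complex.Re C|; first exact: normr_ge0.
  move=> x; have := TC x; rewrite !normE lecE => /andP[_].
  rewrite cReM /= mulr0 subr0 => /le_trans -> //.
  by rewrite ler_wpM2r ?rnorm_ge0 ?ler_norm.
case=> C _ TC; split=> //; exists C%:C => x.
by rewrite !normE -rmorphM lecR.
Qed.

Section Linear.
Variable T : H -> H.
Hypothesis linT : linear T.

Lemma lin0 : T 0 = 0.
Proof. by have := linT (-1) 0 0; rewrite !scaleN1r !addNr. Qed.
Lemma linZ c x : T (c *: x) = c *: T x.
Proof. by have := linT c x 0; rewrite lin0 !addr0. Qed.
Lemma linD x y : T (x + y) = T x + T y.
Proof. by have := linT 1 x y; rewrite !scale1r. Qed.
Lemma linN x : T (- x) = - T x.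
Proof. by rewrite -scaleN1r linZ scaleN1r. Qed.
Lemma linB x y : T (x - y) = T x - T y.
Proof. by rewrite linD linN. Qed.

End Linear.

(** The imaginary part of [<k, x - p>] is the real part of [<- 'i k, x - p>], and [- 'i k] is again
    in [K]. *)
Lemma complex_orthogonal (K : set H) x p :
  (forall c k, K k -> K (c *: k)) -> (forall k, K k -> rinner k (x - p) = 0) ->
  forall k, K k -> '[k, x - p] = 0.
Proof.
move=> KZ o k Kk; apply: complex_ext; first exact: o.
have := o _ (KZ (- 'i) _ Kk); rewrite /rinner innerZl cReM cReN cImN /=.
by rewrite oppr0 mul0r sub0r mulN1r opprK.
Qed.

(* The representing vector is a multiple of the component of a non-zero vector
   that is orthogonal to the kernel. *)
Lemma riesz (f : H -> R[i]) (C : R) :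
    (forall c x y, f (c *: x + y) = c * f x + f y) ->
    (forall x, `|f x| <= (C * rnorm x)%:C) ->
  exists z, forall x, f x = '[x, z].
Proof.
move=> linf fC.
have f0 : f 0 = 0 by have := linf (-1) 0 0; rewrite scaleN1r addNr mulN1r addNr.
have fZ c x : f (c *: x) = c * f x by have := linf c x 0; rewrite f0 !addr0.
have fD x y : f (x + y) = f x + f y by have := linf 1 x y; rewrite scale1r mul1r.
have fB x y : f (x - y) = f x - f y by rewrite fD -scaleN1r fZ mulN1r.
have [fx0|] := pselect (forall x, f x = 0).
  by exists 0 => x; rewrite inner0r.
move=> /existsNP[x0 fx0].
pose K := [set x | f x = 0].
have rK : real_subspace K.
  split; rewrite /K /=; [exact: f0 | by move=> x y fx fy; rewrite fD fx fy addr0|].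
  by move=> t x fx; rewrite fZ fx mulr0.
have [p Kp porth] := real_projection x0 rK.
have fp : f p = 0.
  apply/eqP; rewrite -normr_eq0 normc_def; apply/eqP; congr (_%:C).
  apply/eqP; rewrite eq_le sqrtr_ge0 andbT; apply: (@le0_small _ _ C) => e e0.
  have [k Kk pk] := (closure_rnormP _ _).1 Kp e e0.
  have := fC (p - k); rewrite fB Kk subr0 normc_def lecR => /le_trans; apply.
  have C0 : 0 <= C.
    have h := fC x0.
    have : 0 < `|f x0| by rewrite normr_gt0; apply/eqP.
    move=> /lt_le_trans /(_ h); rewrite ltcR => h'.
    rewrite leNgt; apply/negP => C0.
    by have := mulr_le0_ge0 (ltW C0) (rnorm_ge0 x0); rewrite leNgt h'.
  by rewrite mulrC ler_wpM2r// ltW.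
pose z0 := x0 - p.
have fz0 : f z0 != 0 by rewrite /z0 fB fp subr0; apply/eqP.
have zorth : forall k, f k = 0 -> '[k, z0] = 0.
  by apply: (complex_orthogonal (K := K)) porth => c k; rewrite /K /= fZ => ->; rewrite mulr0.
have z00 : '[z0, z0] != 0.
  rewrite inner_self; apply/eqP => /complexI /eqP; rewrite sqrf_eq0 => /eqP /rnorm_eq0 z00.
  by move: fz0; rewrite z00 f0 eqxx.
exists (Num.conj (f z0 / '[z0, z0]) *: z0) => u.
(* This vector is in the kernel of [f], hence orthogonal to [z0]; solving for [f u] gives the
   formula for the representing vector. *)
have : f (u - (f u / f z0) *: z0) = 0 by rewrite fB fZ divfK// subrr.
move=> /zorth; rewrite innerBl innerZl => /eqP; rewrite subr_eq0 => /eqP uz.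
by rewrite innerZr conjCK uz; field; rewrite z00 fz0.
Qed.

(** The scalar [c] of modulus 1 turns [<c x, y>] into the modulus of [<x, y>], so the real
    inequality [rinner_le] applies. *)
Lemma norm_inner_le x y : `|'[x, y]| <= (rnorm x * rnorm y)%:C.
Proof.
have [->|xy0] := eqVneq '[x, y] 0.
  by rewrite normr0 ler0c mulr_ge0 ?rnorm_ge0.
pose c := Num.conj '[x, y] / `|'[x, y]|.
have n0 : `|'[x, y]| != 0 by rewrite normr_eq0.
have e : '[c *: x, y] = `|'[x, y]|.
  by rewrite innerZl /c mulrAC [Num.conj _ * _]mulrC -normCK expr2 mulfK.
have c1 : `|c| = 1.
  by rewrite /c normrM normfV normr_id norm_conjC divff.
have := rinner_le (c *: x) y; rewrite /rinner e rnormZ c1 -[complex.Re 1]/1 mul1r.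
by rewrite lecR.
Qed.

Lemma adj_ex T : bounded_operators T ->
  forall y, exists z, forall x, '[T x, y] = '[x, z].
Proof.
move=> /bounded_operatorP[linT [C C0 TC]] y.
apply: (@riesz _ (C * rnorm y)) => [c u v|u]; first by rewrite linT innerDl innerZl.
apply: le_trans (norm_inner_le _ _) _; rewrite lecR.
by have := ler_wpM2r (rnorm_ge0 y) (TC u); lra.
Qed.

Lemma inner_adjr T : bounded_operators T -> forall x y, '[T x, y] = '[x, adj T y].
Proof.
move=> bT x y; have [z zP] := adj_ex bT y.
exact: (@xgetI _ 0 [set z | forall x, '[T x, y] = '[x, z]] z zP).
Qed.

Lemma inner_adjl T : bounded_operators T -> forall x y, '[adj T x, y] = '[x, T y].
Proof. by move=> bT x y; rewrite inner_conj -inner_adjr// -inner_conj. Qed.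

Lemma adj_unique T S : bounded_operators T ->
  (forall x y, '[T x, y] = '[x, S y]) -> adj T = S.
Proof.
move=> bT TS; apply/funext => y; apply: eq_innerr => x.
by rewrite -inner_adjr.
Qed.

(** The bound [C] of [T] also serves for the adjoint: [|T^* x|^2 = Re <x, T T^* x> <= C |x| |T^*
    x|], and a non-zero [|T^* x|] cancels. *)
Lemma bounded_adj T : bounded_operators T -> bounded_operators (adj T).
Proof.
move=> bT; apply/bounded_operatorP; split=> [c x y|].
  apply: eq_innerr => u; rewrite innerDr innerZr -!inner_adjr//.
  by rewrite innerDr innerZr.
have /bounded_operatorP[linT [C C0 TC]] := bT.
exists C => // x; have [e|e] := eqVneq (rnorm (adj T x)) 0.
  by rewrite e mulr_ge0 ?rnorm_ge0.
have a0 : 0 < rnorm (adj T x) by rewrite lt0r e rnorm_ge0.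
rewrite -(ler_pM2l a0) -expr2 rnorm2 /rinner inner_adjl //.
apply: le_trans (rinner_le _ _) _; rewrite mulrC.
by have := ler_wpM2r (rnorm_ge0 x) (TC (adj T x)); lra.
Qed.

Lemma adjK T : bounded_operators T -> adj (adj T) = T.
Proof. by move=> bT; apply: adj_unique; [exact: bounded_adj | exact: inner_adjl]. Qed.

Lemma bounded_id : bounded_operators (idfun : H -> H).
Proof.
by apply/bounded_operatorP; split=> //; exists 1 => // x; rewrite mul1r.
Qed.

Lemma bounded_add S T : bounded_operators S -> bounded_operators T ->
  bounded_operators (S \+ T).
Proof.
move=> /bounded_operatorP[lS [C C0 SC]] /bounded_operatorP[lT [D D0 TD]].
apply/bounded_operatorP; split=> [c x y|].
  by rewrite /= lS lT scalerDr addrACA.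
exists (C + D) => [|x]; first exact: addr_ge0.
by rewrite mulrDl; apply: le_trans (rnormD _ _) _; apply: lerD.
Qed.

Lemma bounded_scale c T : bounded_operators T -> bounded_operators (c \*: T).
Proof.
move=> /bounded_operatorP[lT [D D0 TD]].
apply/bounded_operatorP; split=> [d x y|].
  by rewrite /= lT scalerDr !scalerA mulrC.
have c0 : 0 <= complex.Re `|c| by rewrite normc_def sqrtr_ge0.
exists (complex.Re `|c| * D) => [|x]; first exact: mulr_ge0.
by rewrite /= rnormZ -mulrA ler_wpM2l.
Qed.

Lemma bounded_comp S T : bounded_operators S -> bounded_operators T ->
  bounded_operators (S \o T).
Proof.
move=> /bounded_operatorP[lS [C C0 SC]] /bounded_operatorP[lT [D D0 TD]].
apply/bounded_operatorP; split=> [c x y|]; first by rewrite /= lT lS.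
exists (C * D) => [|x]; first exact: mulr_ge0.
by apply: le_trans (SC _) _; rewrite -mulrA ler_wpM2l.
Qed.

Lemma adj_add S T : bounded_operators S -> bounded_operators T ->
  adj (S \+ T) = adj S \+ adj T.
Proof.
move=> bS bT; apply: adj_unique; first exact: bounded_add.
by move=> x y; rewrite /= innerDl innerDr -!inner_adjr.
Qed.

Lemma adj_scale c T : bounded_operators T ->
  adj (c \*: T) = Num.conj c \*: adj T.
Proof.
move=> bT; apply: adj_unique; first exact: bounded_scale.
by move=> x y; rewrite /= innerZl innerZr conjCK -inner_adjr.
Qed.

Lemma adj_comp S T : bounded_operators S -> bounded_operators T ->
  adj (S \o T) = adj T \o adj S.
Proof.
move=> bS bT; apply: adj_unique; first exact: bounded_comp.
by move=> x y; rewrite /= -!inner_adjr.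
Qed.

Lemma adj_id : adj (idfun : H -> H) = idfun.
Proof. by apply: adj_unique => //; exact: bounded_id. Qed.

End Adjoint.

(** * Star algebras of bounded operators and their commutants *)

Section StarAlgebra.
Context {R : realType} {H : hilbertType R}.
Implicit Types (x y p q u v : H) (A M : set (H -> H)) (T m n : H -> H) (c : R[i]).

(** A von Neumann algebra and its commutant are both treated as star algebras, so that the later
    lemmas can be applied with the two exchanged. *)
Record star_algebra A : Prop := {
  sa_bounded : A `<=` bounded_operators;
  sa_id : A idfun;
  sa_add : forall S T, A S -> A T -> A (S \+ T);
  sa_scale : forall c T, A T -> A (c \*: T);
  sa_comp : forall S T, A S -> A T -> A (S \o T);
  sa_adj : forall T, A T -> A (adj T)
}.

Lemma von_neumann_star_algebra M : von_neumann_algebra M -> star_algebra M.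
Proof. by case=> *; split. Qed.

Lemma commutantP M T : commutant M T <->
  bounded_operators T /\ forall m, M m -> forall x, T (m x) = m (T x).
Proof.
split=> -[bT cT]; split=> // m Mm; last by apply/funext => x; rewrite /= cT.
by move=> x; have /(congr1 (fun f => f x)) := cT m Mm.
Qed.

Lemma commutant_star_algebra A : star_algebra A -> star_algebra (commutant A).
Proof.
move=> sA; have lA m : A m -> linear m by move=> /(sa_bounded sA)[].
split.
- by move=> T [].
- by apply/commutantP; split=> //; exact: bounded_id.
- move=> S T /commutantP[bS cS] /commutantP[bT cT]; apply/commutantP; split.
    exact: bounded_add.
  by move=> m Am x; rewrite /= cS// cT// linD//; exact: lA.
- move=> c T /commutantP[bT cT]; apply/commutantP; split.
    exact: bounded_scale.
  by move=> m Am x; rewrite /= cT// linZ//; exact: lA.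
- move=> S T /commutantP[bS cS] /commutantP[bT cT]; apply/commutantP; split.
    exact: bounded_comp.
  by move=> m Am x; rewrite /= cT// cS.
- move=> T /commutantP[bT cT]; apply/commutantP; split; first exact: bounded_adj.
  move=> m Am x; apply: eq_innerr => y.
  have bm := sa_bounded sA Am.
  rewrite -inner_adjr// -[in RHS](adjK bm) -inner_adjr; last exact: bounded_adj.
  rewrite -inner_adjr// cT; last exact: sa_adj.
  by rewrite inner_adjl.
Qed.

(** * A contraction in the commutant obtained from an equality of norms *)

Section Intertwiner.
Variables (A : set (H -> H)) (p q : H).
Hypotheses (sA : star_algebra A).
Hypothesis pq : forall m, A m -> rnorm (m p) = rnorm (m q).

Let linA m : A m -> linear m. Proof. by move=> /(sa_bounded sA)[]. Qed.

(* The graph of the operator that vanishes on the orthogonal complement of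
   [A p] and maps [m p] to [m q]. *)
Let W x v := exists u, (forall n, A n -> '[n p, x - u] = 0) /\
  forall e : R, 0 < e ->
    exists m, [/\ A m, rnorm (u - m p) < e & rnorm (v - m q) < e].

Let W_linear c x v y v' : W x v -> W y v' -> W (c *: x + y) (c *: v + v').
Proof.
move=> [u [ou uv]] [u' [ou' uv']]; exists (c *: u + u'); split.
  move=> n An.
  have -> : c *: x + y - (c *: u + u') = c *: (x - u) + (y - u').
    by rewrite scalerBr opprD addrACA.
  by rewrite innerDr innerZr ou// ou'// mulr0 addr0.
move=> e e0.
have c0 : 0 <= complex.Re `|c| by rewrite normc_def sqrtr_ge0.
have c1 : 0 < complex.Re `|c| + 1 by rewrite ltr_wpDl.
(* The added 1 keeps the divisor positive when [c = 0]. *)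
have [|m [Am um vm]] := uv (e / 2 / (complex.Re `|c| + 1)).
  by rewrite !divr_gt0.
have [|m' [Am' um' vm']] := uv' (e / 2); first by rewrite divr_gt0.
have H2 a b a' b' : rnorm (a - b) < e / 2 / (complex.Re `|c| + 1) ->
    rnorm (a' - b') < e / 2 -> rnorm (c *: a + a' - (c *: b + b')) < e.
  have -> : c *: a + a' - (c *: b + b') = c *: (a - b) + (a' - b').
    by rewrite scalerBr opprD addrACA.
  move=> ab ab'; apply: le_lt_trans (rnormD _ _) _.
  rewrite rnormZ [e in _ < e](splitr e); apply: ler_ltD => //.
  have : (complex.Re `|c| + 1) * rnorm (a - b) <= e / 2.
    by rewrite mulrC -ler_pdivlMr// ltW.
  by apply: le_trans; rewrite ler_wpM2r ?rnorm_ge0// lerDl.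
exists ((c \*: m) \+ m'); split; [|exact: H2|exact: H2].
by apply: sa_add => //; apply: sa_scale.
Qed.

(** Here [|v| = |u|], because [v] and [u] are limits of [m q] and [m p], which have equal norms; and
    [|u| <= |x|], because [u] is orthogonal to [x - u]. *)
Let W_contraction x v : W x v -> rnorm v <= rnorm x.
Proof.
move=> [u [ou uv]]; apply: (@le_trans _ _ (rnorm u)).
  rewrite -subr_le0; apply: (@le0_small _ _ 2) => e /uv[m [Am um vm]].
  have h1 := rnormD (v - m q) (m q); rewrite subrK in h1.
  have h2 := rnormD (m p - u) u; rewrite subrK (rnormC _ u) (pq Am) in h2.
  lra.
have ux : rinner u (x - u) = 0.
  apply/eqP; rewrite -normr_eq0 eq_le normr_ge0 andbT.
  apply: (@le0_small _ _ (rnorm (x - u))) => e /uv[m [Am um _]].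
  have -> : rinner u (x - u) = rinner (u - m p) (x - u).
    by rewrite (rinnerBl u) [rinner (m p) _]/rinner ou// subr0.
  have : rnorm (u - m p) * rnorm (x - u) <= e * rnorm (x - u).
    by rewrite ler_wpM2r ?rnorm_ge0 ?ltW.
  rewrite ler_norml.
  by have := rinner_le (u - m p) (x - u); have := rinner_ge (u - m p) (x - u); lra.
have [u0|u0] := eqVneq (rnorm u) 0; first by rewrite u0 rnorm_ge0.
have up : 0 < rnorm u by rewrite lt0r u0 rnorm_ge0.
rewrite -(ler_pM2l up) -expr2 rnorm2.
by have := rinner_le u x; move: ux; rewrite rinnerBr; lra.
Qed.

(** By linearity [W] relates 0 to the difference of the two values, and [W_contraction] makes this
    difference vanish. *)
Let W_functional x v v' : W x v -> W x v' -> v = v'.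
Proof.
move=> xv xv'; have := W_contraction (W_linear (-1) xv' xv).
rewrite !scaleN1r addNr => h; apply/eqP; rewrite eq_sym -subr_eq0 -opprB oppr_eq0.
rewrite addrC; apply/eqP/rnorm_eq0/eqP; rewrite eq_le rnorm_ge0 andbT.
apply: le_trans h _.
by rewrite /rnorm normr0.
Qed.

(** Take for [u] the projection of [x] to the closure of [A p], with [r i p] tending to [u]. The
    hypothesis [pq], applied to [r i - r j], shows that [r i q] is Cauchy; its limit is the value at
    [x]. *)
Let W_total x : exists v, W x v.
Proof.
pose K := [set m p | m in A].
have KZ c k : K k -> K (c *: k).
  by move=> [m Am <-]; exists (c \*: m) => //; exact: sa_scale.
have rK : real_subspace K.
  split=> [|_ _ [m Am <-] [n An <-]|t k]; last exact: KZ.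
  - by rewrite -(scale0r p); apply: KZ; exists idfun => //; exact: sa_id.
  - by exists (m \+ n) => //; exact: sa_add.
have [u Ku ou] := real_projection x rK.
have {}ou := complex_orthogonal KZ ou.
have /choice[r rP] (i : nat) : exists m, A m /\ rnorm (u - m p) < i.+1%:R^-1.
  have [|_ [m Am <-] um] := (closure_rnormP _ _).1 Ku i.+1%:R^-1.
    by rewrite invr_gt0.
  by exists m.
have [e e0|v vP] := rnorm_complete (u := fun i => r i q).
  have [|n0 h] := @invS_small _ (e / 2); first by rewrite divr_gt0.
  exists n0 => i j /h hi /h hj; have [Ai ui] := rP i; have [Aj uj] := rP j.
  have : A (r i \+ (-1) \*: r j) by apply: sa_add => //; exact: sa_scale.
  move=> /pq; rewrite /= !scaleN1r => <-.
  have -> : r i p - r j p = (r i p - u) + (u - r j p) by rewrite addrA subrK.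
  apply: le_lt_trans (rnormD _ _) _; rewrite (rnormC _ u) [e]splitr.
  by apply: ltrD; [apply: lt_trans hi | apply: lt_trans hj].
exists v, u; split=> [n An|e e0]; first by apply: ou; exists n.
have [n1 h1] := vP e e0; have [n2 h2] := invS_small e0.
have [An un] := rP (maxn n1 n2).
exists (r (maxn n1 n2)); split=> //; last by apply: h1; rewrite leq_maxl.
by apply: lt_trans un _; apply: h2; rewrite leq_maxr.
Qed.

(** The vector [b (x - u)] stays orthogonal to [A p] because [A] contains [adj b \o n] for each [n]
    in [A]. *)
Let W_commute b x v : A b -> W x v -> W (b x) (b v).
Proof.
move=> Ab [u [ou uv]]; have lb := linA Ab; exists (b u); split=> [n An|e e0].
  have bb := sa_bounded sA Ab.
  rewrite -linB// -inner_adjl//; apply: (ou (adj b \o n)).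
  by apply: sa_comp => //; exact: sa_adj.
have /bounded_operatorP[_ [C C0 bC]] := sa_bounded sA Ab.
have C1 : 0 < C + 1 by rewrite ltr_wpDl.
have [|m [Am um vm]] := uv (e / (C + 1)); first by rewrite divr_gt0.
have H2 a a' : rnorm (a - a') < e / (C + 1) -> rnorm (b a - b a') < e.
  move=> aa; rewrite -linB//; apply: le_lt_trans (bC _) _.
  apply: (@le_lt_trans _ _ ((C + 1) * rnorm (a - a'))).
    by rewrite ler_wpM2r ?rnorm_ge0// lerDl.
  by rewrite mulrC -ltr_pdivlMr.
by exists (b \o m); split; [exact: sa_comp | exact: H2 | exact: H2].
Qed.

(** The operator [w] picks a value of [W] at each point. Linearity, commutation with [A] and
    [w p = q] each follow from [W_functional], since both sides of the equation are values of [W] at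
    the same point. *)
Lemma intertwiner : exists w, [/\ commutant A w,
  forall x, rnorm (w x) <= rnorm x & w p = q].
Proof.
have /choice[w wP] := W_total.
exists w; split=> [|x|]; last first.
- apply: (W_functional (wP p)); exists p; split=> [n An|e e0].
    by rewrite subrr inner0r.
  by exists idfun; split; [exact: sa_id | |]; rewrite subrr /rnorm normr0.
- exact: W_contraction.
apply/commutantP; split=> [|m Am x]; last first.
  exact: (W_functional (wP _) (W_commute Am (wP x))).
apply/bounded_operatorP; split; last first.
  by exists 1 => // x; rewrite mul1r; exact: W_contraction.
by move=> c x y; exact: (W_functional (wP _) (W_linear c (wP x) (wP y))).
Qed.

End Intertwiner.

End StarAlgebra.

(** * Triviality of the real orthogonal complement of [K + 'i K'] *)

Section Density.
Context {R : realType} {H : hilbertType R}.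
Variables (A : set (H -> H)) (xi : H).
Hypotheses (sA : star_algebra A) (cyclic : cyclic_vector A xi).

Lemma cyclic_density z :
    (forall a, A a -> adj a = a -> rinner (a xi) z = 0) ->
    (forall b, commutant A b -> adj b = b -> complex.Im '[b xi, z] = 0) ->
  z = 0.
Proof.
move=> zA zA'.
have bA m : A m -> bounded_operators m by move/(sa_bounded sA).
have [||w [cw w1 wz]] := @intertwiner _ _ A (xi + z) (xi - z) => // [m Am|].
  (* The operator [m^* m] is self-adjoint, so [Re <m xi, m z> = Re <m^* m xi, z> = 0]; hence
     [m (xi + z)] and [m (xi - z)] have equal norms. *)
  have mz : rinner (m xi) (m z) = 0.
    rewrite /rinner -inner_adjl; last exact: bA.
    apply: (zA (adj m \o m)); first by apply: sa_comp => //; exact: sa_adj.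
    by rewrite adj_comp ?adjK//; [exact: bA | exact/bounded_adj/bA | exact: bA].
  have [lm _] := bA m Am.
  apply/eqP; rewrite -(@eqrXn2 _ 2)// ?rnorm_ge0//.
  rewrite !rnorm2 (linB lm) (linD lm) !rinnerE (rinnerC (m z)) mz; apply/eqP; ring.
have sA' := commutant_star_algebra sA.
have [bw cw'] := (commutantP A w).1 cw.
have [lw _] := bw.
have wsym : rinner (w xi) z = rinner (w z) xi.
  pose b := (- 'i) \*: (w \+ (-1) \*: adj w).
  have Ab : commutant A b.
    by apply: sa_scale => //; apply: sa_add => //; apply: sa_scale => //; exact: sa_adj.
  have bw' := bounded_adj bw; have bw'' := bounded_scale (-1) bw'.
  have adjb : adj b = b.
    rewrite /b adj_scale ?adj_add ?adj_scale ?adjK//; last exact: bounded_add.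
    have -> : Num.conj (- 'i) = 'i :> R[i] by apply: complex_ext => /=; lra.
    have -> : Num.conj (- 1) = - 1 :> R[i] by apply: complex_ext => /=; lra.
    apply/funext => x /=; rewrite !scaleN1r.
    by rewrite scaleNr -scalerN opprB.
  have := zA' b Ab adjb.
  rewrite /b /= innerZl cImM innerDl innerZl cReD cImD cReM cImM /=.
  rewrite inner_adjl // => h; rewrite (rinnerC (w z)) /rinner.
  move: h; rewrite !oppr0 !mul0r; lra.
have z0 : rinner xi z = 0 by apply: (zA idfun); [exact: sa_id | exact: adj_id].
have e2 : w xi = xi - z - w z by rewrite -wz (linD lw) addrK.
have e1 : w xi - xi = - (z + w z).
  by rewrite e2 addrAC [xi - z - xi]addrAC subrr sub0r -opprD.
have w1x : rinner (w xi) (w xi) <= rinner xi xi.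
  by rewrite -!rnorm2 ler_sqr ?nnegrE ?rnorm_ge0.
have w1z : rinner (w z) (w z) <= rinner z z.
  by rewrite -!rnorm2 ler_sqr ?nnegrE ?rnorm_ge0.
(* This and [ezz] come from pairing [w xi = xi - z - w z] with [xi] and with [z]. They turn the
   contraction bounds [w1x] and [w1z] into the two opposite bounds for [|w xi - xi|^2]. *)
have exx : rinner (w xi) xi = rinner xi xi - rinner (w xi) z.
  by rewrite wsym {1}e2 !rinnerE (rinnerC z) z0 subr0.
have ezz : rinner (w z) z = - rinner z z - rinner (w xi) z.
  by have := congr1 (fun v => rinner v z) e2; rewrite !rinnerE z0 sub0r => ->; lra.
have wxi : w xi = xi.
  apply/eqP; rewrite -subr_eq0; apply/eqP/rnorm_eq0/eqP; rewrite -sqrf_eq0.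
  rewrite eq_le sqr_ge0 andbT.
  have : rnorm (w xi - xi) ^+ 2 <= 2 * rinner (w xi) z.
    by rewrite rnorm2 !rinnerE (rinnerC xi (w xi)) exx; lra.
  have : rnorm (w xi - xi) ^+ 2 <= - 2 * rinner (w xi) z.
    by rewrite e1 rnormN rnorm2 !rinnerE (rinnerC z (w z)) ezz; lra.
  by lra.
have wzN : w z = - z.
  by move: e1; rewrite wxi subrr => /eqP; rewrite eq_sym oppr_eq0 addrC addr_eq0 => /eqP.
(* The operator [w] commutes with [A] and fixes [xi], hence fixes the dense set [A xi].
   Approximating [x] by [m xi] within [e] costs [e] twice, as [w] is a contraction. *)
have wid x : w x = x.
  apply/eqP; rewrite -subr_eq0; apply/eqP/rnorm_eq0/eqP; rewrite eq_le rnorm_ge0 andbT.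
  apply: (@le0_small _ _ 2) => e e0.
  have [_ [m Am <-] xm] :=
    (closure_rnormP _ _).1 ((dense_closure _).1 cyclic x) e e0.
  have -> : w x - x = w (x - m xi) + (m xi - x).
    by rewrite (linB lw) cw'// wxi addrA subrK.
  apply: le_trans (rnormD _ _) _; rewrite (rnormC _ x).
  by have := w1 (x - m xi); lra.
have zN : z = - z by rewrite -wzN wid.
apply: rnorm_eq0; apply/eqP; rewrite -sqrf_eq0 rnorm2.
have := congr1 (fun v => rinner v z) zN; rewrite {2}/rinner innerNl cReN -/(rinner z z).
by move=> h; apply/eqP; lra.
Qed.

End Density.

(** * Closures and adjoints of the Tomita operators *)

Section Maximality.
Context {R : realType} {H : hilbertType R}.
Implicit Types (A B : set (H -> H)) (G : set (H * H)) (xi x y : H).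

(** The graph of an adjoint is closed: replacing a pair by one within [e] in each component changes
    the two sides of its defining equation by at most [e (|psi| + |phi|)] together. *)
Lemma closure_sub_conj_adjoint G G' :
  G `<=` conj_adjoint G' -> closure G `<=` conj_adjoint G'.
Proof.
move=> GG' [x y] /closure_prodP Gxy phi psi Gphi /=; apply/eqP.
rewrite -subr_eq0 -normr_eq0 normc_def; apply/eqP; congr (_%:C); apply/eqP.
rewrite eq_le sqrtr_ge0 andbT.
apply: (@le0_small _ _ (rnorm psi + rnorm phi)) => e e0.
have [a [b [Gab xa yb]]] := Gxy e e0.
rewrite -lecR -normc_def.
have -> : '[psi, x] - Num.conj '[phi, y] = '[psi, x - a] - Num.conj '[phi, y - b].
  by rewrite !innerBr rmorphB /= (GG' _ Gab _ _ Gphi) /=; ring.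
apply: le_trans (ler_normB _ _) _; rewrite norm_conjC mulrDr rmorphD.
apply: lerD; apply: le_trans (norm_inner_le _ _) _; rewrite lecR mulrC.
  by rewrite ler_wpM2r ?rnorm_ge0// ltW.
by rewrite ler_wpM2r ?rnorm_ge0// ltW.
Qed.

Section CommutingAlgebras.
Variables (A B : set (H -> H)) (xi : H).
Hypotheses (sA : star_algebra A) (sB : star_algebra B).
Hypothesis AB : forall a b x, A a -> B b -> a (b x) = b (a x).

Let bA a : A a -> bounded_operators a. Proof. exact: (sa_bounded sA). Qed.
Let bB b : B b -> bounded_operators b. Proof. exact: (sa_bounded sB). Qed.

(** Since [a] and [b] commute, [<b^* xi, a xi>] and [<a^* xi, b xi>] both equal [<xi, a b xi>]. *)
Lemma S_op_sub_conj_adjoint : S_op A xi `<=` conj_adjoint (S_op B xi).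
Proof.
move=> _ [a Aa <-] _ _ [b Bb [<- <-]] /=.
rewrite (inner_adjl (bB Bb)) -AB// -inner_conj.
by rewrite inner_adjl //; exact: bA.
Qed.

(** The value at [a xi] is well defined because [<a^* xi, b xi> = <xi, b a xi>] depends only on
    [a xi], and the vectors [b xi] are dense. *)
Lemma S_op_conj_linear :
  dense [set b xi | b in B] -> conj_linear_operator (S_op A xi).
Proof.
move=> dB; split.
- move=> x y z [a Aa [ax <-]] [a' Aa' [a'x <-]].
  apply/eqP; rewrite -subr_eq0; apply/eqP; set v := _ - _.
  have vB b : B b -> rinner v (b xi) = 0.
    move=> Bb; rewrite /v /rinner innerBl !inner_adjl; [|exact: bA|exact: bA].
    by rewrite (AB xi Aa Bb) (AB xi Aa' Bb) ax a'x subrr.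
  apply: rnorm_eq0; apply/eqP; rewrite -sqrf_eq0 rnorm2 eq_le rinner_ge0 andbT.
  apply: (@le0_small _ _ (rnorm v)) => e e0.
  have [_ [b Bb <-] xb] := (closure_rnormP _ _).1 ((dense_closure _).1 dB v) e e0.
  rewrite -[rinner v v]subr0 -(vB b Bb) -rinnerBr.
  apply: le_trans (rinner_le _ _) _; rewrite mulrC.
  by rewrite ler_wpM2r ?rnorm_ge0// ltW.
- exists (0 \*: idfun); first by apply: sa_scale => //; exact: sa_id.
  rewrite adj_scale; last exact: bounded_id.
  by rewrite /= rmorph0 !scale0r.
- move=> c x y x' y' [a Aa [<- <-]] [a' Aa' [<- <-]].
  have bc := bounded_scale c (bA Aa).
  exists ((c \*: a) \+ a'); first by apply: sa_add => //; exact: sa_scale.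
  by rewrite adj_add// ?adj_scale//; exact: bA.
Qed.

Lemma S_op_densely_defined :
  dense [set a xi | a in A] -> densely_defined (S_op A xi).
Proof.
move=> dA O O0 oO; have [x [Ox [a Aa ax]]] := dA O O0 oO.
by exists x; split=> //; exists (adj a xi), a => //; rewrite ax.
Qed.

(** A hypothesis of the section, so that the results hold for an algebra with its commutant in
    either order: [cyclic_density] supplies one order, and the other is deduced from it. *)
Hypothesis density : forall z,
    (forall a, A a -> adj a = a -> rinner (a xi) z = 0) ->
    (forall b, B b -> adj b = b -> complex.Im '[b xi, z] = 0) ->
  z = 0.

Let K := [set a xi | a in [set a | A a /\ adj a = a]].

Let real_subspaceK : real_subspace K.
Proof.
have KZ (t : R) x : K x -> K (t%:C *: x).
  move=> [a [Aa aa] <-]; exists (t%:C \*: a) => //; split; first exact: sa_scale.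
  by rewrite adj_scale ?conj_realC ?aa//; exact: bA.
split=> // [|_ _ [a [Aa aa] <-] [b [Ab bb] <-]].
  by rewrite -(scale0r xi); apply: (KZ 0); exists idfun => //; split; [exact: sa_id | exact: adj_id].
exists (a \+ b) => //; split; first exact: sa_add.
by rewrite adj_add ?aa ?bb//; exact: bA.
Qed.

(** For self-adjoint [a] and [b] the number [<b xi, a xi>] is real, as they commute; in the limit
    [<b xi, p>] is real for the projection [p] of [x]. So [x - p] satisfies both conditions of
    [density] and vanishes. *)
Let closureK x :
  (forall b, B b -> adj b = b -> complex.Im '[b xi, x] = 0) -> closure K x.
Proof.
move=> xB; have [p Kp po] := real_projection x real_subspaceK.
suff -> : x = p by [].
apply/eqP; rewrite -subr_eq0; apply/eqP; apply: density => [a Aa aa|b Bb bb].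
  by apply: po; exists a.
rewrite innerBr cImD cImN xB// sub0r; apply/eqP; rewrite oppr_eq0.
rewrite -normr_eq0 eq_le normr_ge0 andbT.
apply: (@le0_small _ _ (rnorm (b xi))) => e e0.
have [_ [a [Aa aa] <-] pa] := (closure_rnormP _ _).1 Kp e e0.
have ba : complex.Im '[b xi, a xi] = 0.
  have : '[b xi, a xi] = Num.conj '[b xi, a xi].
    rewrite -inner_conj -(inner_adjl (bA Aa)) aa AB// -[in RHS]bb.
    by rewrite -(inner_adjr (bB Bb)).
  by move=> /(congr1 (@complex.Im R)); rewrite cImJ; lra.
have -> : complex.Im '[b xi, p] = rinner (b xi) ('i *: (p - a xi)).
  by rewrite -Im_inner innerBr cImD cImN ba oppr0 addr0.
have i1 : rnorm ('i *: (p - a xi)) = rnorm (p - a xi).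
  by rewrite rnormZ normc_def /= expr0n add0r expr1n sqrtr1 mul1r.
have : rnorm (b xi) * rnorm (p - a xi) <= e * rnorm (b xi).
  by rewrite mulrC ler_wpM2r ?rnorm_ge0// ltW.
rewrite ler_norml -i1.
by have := rinner_le (b xi) ('i *: (p - a xi));
  have := rinner_ge (b xi) ('i *: (p - a xi)); lra.
Qed.

Lemma closure_S_op : closure (S_op A xi) = conj_adjoint (S_op B xi).
Proof.
apply/seteqP; split.
  exact/closure_sub_conj_adjoint/S_op_sub_conj_adjoint.
move=> [psi eta] h.
(* For self-adjoint [b] the numbers [<b xi, psi>] and [<b xi, eta>] are conjugate. Hence [<b xi, x>]
   is the real part and [<b xi, y>] the imaginary part of [<b xi, eta>], both real. *)
have {}h b : B b -> adj b = b -> '[b xi, psi] = Num.conj '[b xi, eta].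
  by move=> Bb bb; apply: h => /=; exists b; rewrite ?bb.
pose x := (2^-1)%:C *: (psi + eta); pose y := ((2^-1)%:C * - 'i) *: (psi - eta).
have Kx : closure K x.
  apply: closureK => b Bb bb; rewrite innerZr innerDr h// cImM cImD cReD cImJ cReJ /=.
  by lra.
have Ky : closure K y.
  apply: closureK => b Bb bb.
  rewrite innerZr innerBr h// !(cReM, cImM, cReJ, cImJ, cReD, cImD, cReN, cImN) /=.
  by lra.
have yi : 'i *: y = (2^-1)%:C *: (psi - eta).
  rewrite /y scalerA; congr (_ *: _); apply: complex_ext; rewrite !(cReM, cImM, cReN, cImN) /=; lra.
have half (v : H) : (2^-1)%:C *: v + (2^-1)%:C *: v = v.
  rewrite -scalerDl -[RHS]scale1r; congr (_ *: _); apply: complex_ext => /=; lra.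
have psiE : psi = x + 'i *: y.
  by rewrite yi /x -scalerDr addrACA subrr addr0 scalerDr half.
have etaE : eta = x - 'i *: y.
  by rewrite yi /x -scalerBr opprB [psi + eta]addrC addrACA subrr addr0 scalerDr half.
have i1 (v : H) : rnorm ('i *: v) = rnorm v.
  by rewrite rnormZ normc_def /= expr0n add0r expr1n sqrtr1 mul1r.
apply/closure_prodP => e e0; have e2 : 0 < e / 2 by rewrite divr_gt0.
have [_ [a [Aa aa] <-] xa] := (closure_rnormP _ _).1 Kx _ e2.
have [_ [b [Ab bb] <-] yb] := (closure_rnormP _ _).1 Ky _ e2.
(* This is the pair of [S_op A xi] given by [a + 'i b], whose adjoint is [a - 'i b]. *)
exists (a xi + 'i *: b xi), (a xi - 'i *: b xi); split.
- exists (a \+ 'i \*: b); first by apply: sa_add => //; exact: sa_scale.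
  rewrite adj_add; [|exact: bA|exact/bounded_scale/bA].
  rewrite adj_scale; last exact: bA.
  by rewrite aa bb conj_iC /= scaleNr.
- rewrite psiE opprD addrACA -scalerBr; apply: le_lt_trans (rnormD _ _) _.
  by rewrite i1; lra.
- rewrite etaE opprD opprK addrACA -scalerN -scalerDr; apply: le_lt_trans (rnormD _ _) _.
  by rewrite i1 [- y + _]addrC (rnormC _ y); lra.
Qed.

End CommutingAlgebras.

End Maximality.

Theorem theorem4p11 (R : realType) (H : hilbertType R) (M : set (H -> H))
    (xi : H) (vnM : von_neumann_algebra M) (xi_unit : `|xi| = 1)
    (xi_cyclic : cyclic_vector M xi) (xi_separating : separating_vector M xi) :
  maximal_symmetric_pair (S_op M xi) (F_op M xi).
Proof.
have sM := von_neumann_star_algebra vnM.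
have sM' := commutant_star_algebra sM.
have MM' m m' x : M m -> commutant M m' -> m (m' x) = m' (m x).
  by move=> Mm /commutantP[_ ->].
have M'M m' m x : commutant M m' -> M m -> m' (m x) = m (m' x).
  by move=> M'm' Mm; rewrite (MM' m).
have density := cyclic_density sM xi_cyclic.
have density' z :
    (forall m', commutant M m' -> adj m' = m' -> rinner (m' xi) z = 0) ->
    (forall m, M m -> adj m = m -> complex.Im '[m xi, z] = 0) -> z = 0.
  (* Multiplication by ['i] exchanges the two conditions up to sign:
     [Re <m xi, 'i z> = Im <m xi, z>] and [Im <m' xi, 'i z> = - Re <m' xi, z>]. *)
  move=> zM' zM; have : 'i *: z = 0.
    apply: density => [m Mm mm|m' Mm' mm']; first by rewrite -Im_inner zM.
    have := zM' m' Mm' mm'; rewrite /rinner innerZr conj_iC cImM /= => ->.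
    by rewrite oppr0 mul0r mulr0 addr0.
  move=> /eqP; rewrite scaler_eq0 => /orP[/eqP|/eqP//].
  by move=> /(congr1 (@complex.Im R)) /= /eqP; rewrite oner_eq0.
(* By definition [F_op M xi] is [S_op (commutant M) xi], so each lemma on [S_op] serves for both
   operators, with the algebras exchanged. *)
split; last 2 first.
- exact: closure_S_op.
- exact: closure_S_op.
split.
- exact: S_op_conj_linear MM' xi_separating.
- exact: S_op_conj_linear M'M xi_cyclic.
- exact: S_op_densely_defined.
- exact: S_op_densely_defined.
- move=> phi Sphi psi Fpsi Sp Fp.
  exact: (S_op_sub_conj_adjoint sM' sM M'M Fp Sp).
Qed.
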